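(* Let $G$ be a finite directed graph, $k\ge1$ an integer, $r\in V(G)$ with positive in-degree and positive out-degree, and $\lambda,\delta\in(0,1)$. Suppose the sampling loop of algorithm APAD (described in the context) is executed a fixed number $\boldsymbol{\tau}$ of times, producing $\mathbf{c}=\frac1{\boldsymbol{\tau}}\sum_{\tau=1}^{\boldsymbol{\tau}}\mathbf{c}_\tau$. Then for all sufficiently large $\boldsymbol{\tau}$, $\mathbf{c}$ is a $(\lambda,\delta)$-approximation of $pc(r)$, i.e. $\mathbb{P}\left[|\mathbf{c}-pc(r)|\ge\lambda\right]\le\delta$.
   Context: $G$ is a finite, unweighted directed graph without self-loops or multiple edges, assumed (weakly) connected. $N(v)$ is the set of out-neighbours of $v$. For a vertex $s$ and integer $l\ge1$, $p_{s,l}$ denotes a simple directed path $s=u_0,u_1,\dots,u_l$ with $l$ edges starting at $s$; define $\mathcal{W}(p_{s,l})=\prod_{i=1}^{l}\frac{1}{|N(u_{i-1})\setminus\{s,u_1,\dots,u_{i-2}\}|}$ (for $i=1$ the removed set is $\{s\}$). $\chi[r\in p_{s,l}]$ is $1$ if $r$ is a vertex of $p_{s,l}$ and $0$ otherwise. The $k$-path centrality of $r$ is $pc(r)=\frac{1}{k|V(G)|}\sum_{s\in V(G)\setminus\{r\}}\sum_{1\le l\le k}\sum_{p_{s,l}}\chi[r\in p_{s,l}]\,\mathcal{W}(p_{s,l})$, the innermost sum over all simple paths with $l$ edges starting at $s$. $\mathcal{RF}(r)$ is the set of vertices $s\ne r$ with a directed path from $s$ to $r$; $\mathcal{RT}(r)$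 is the set of vertices $t\ne r$ with a directed path from $r$ to $t$; $\mathcal{D}(r)=\mathcal{RF}(r)\cup\{r\}\cup\mathcal{RT}(r)$. Algorithm APAD: let $RF=\mathcal{RF}(r)$, $D=\mathcal{D}(r)$. In each iteration $\tau$, independently: choose $s\in RF$ uniformly at random and $l\in\{1,\dots,k\}$ uniformly at random; build a path starting from $u_0=s$ where, for $i=1,\dots,l$, $u_i$ is chosen uniformly at random from $(N(u_{i-1})\cap D)\setminus\{s,u_1,\dots,u_{i-2}\}$; if this set is empty at some step, set $\mathbf{c}_\tau=0$. Otherwise the result is a path $p_{s,l}$ with $\mathbb{P}[p_{s,l}]=\prod_{i=1}^{l}\frac{1}{|(N(u_{i-1})\cap D)\setminus\{s,u_1,\dots,u_{i-2}\}|}$, and set $\mathbf{c}_\tau=\frac{|RF|\,\mathcal{W}(p_{s,l})}{|V(G)|\,\mathbb{P}[p_{s,l}]}$ if $r$ lies on $p_{s,l}$ and $\mathbf{c}_\tau=0$ otherwise. *)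

(* Defs.v *)
From HB Require Import structures.
From mathcomp Require Import all_boot all_order all_algebra.
From mathcomp Require Import all_classical all_reals all_analysis.

Set Implicit Arguments.
Unset Strict Implicit.
Unset Printing Implicit Defensive.

Import Order.TTheory GRing.Theory Num.Theory.
Local Open Scope ring_scope.

(* A finite digraph without multiple edges is a relation e on a finType V; a
   path u_0 = s, u_1, .., u_l is the pair of s and q = [:: u_1; ..; u_l].     *)

Section Graph.

Variables (V : finType) (e : rel V).

Definition weakly_connected : Prop :=
  forall x y : V, connect (fun a b => e a b || e b a) x y.

Definition outN (v : V) : {set V} := [set w | e v w].
Definition inN (v : V) : {set V} := [set u | e u v].

Definition RF (r : V) : {set V} := [set s | (s != r) && connect e s r].
Definition RT (r : V) : {set V} := [set t | (t != r) && connect e r t].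
Definition DD (r : V) : {set V} := RF r :|: [set r] :|: RT r.

Definition simple_path (s : V) (q : seq V) : bool :=
  path e s q && uniq (s :: q).

(* {s, u_1, .., u_(i-2)} for i >= 1; as the subtraction is truncated, this is
   {s} for i = 1.                                                            *)
Definition removed (s : V) (q : seq V) (i : nat) : {set V} :=
  s |: [set x in take (i - 2)%N q].

Definition nextW (s : V) (q : seq V) (i : nat) : {set V} :=
  outN (nth s (s :: q) i.-1) :\: removed s q i.

Definition nextD (r s : V) (q : seq V) (i : nat) : {set V} :=
  (outN (nth s (s :: q) i.-1) :&: DD r) :\: removed s q i.

End Graph.

Section Centrality.

Variables (R : realType) (V : finType) (e : rel V).

Definition path_weight (s : V) (q : seq V) : R :=
  \prod_(1 <= i < (size q).+1) (#|nextW e s q i|%:R)^-1.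

Definition path_centrality (k : nat) (r : V) : R :=
  (k%:R * #|V|%:R)^-1 *
  \sum_(s : V | s != r) \sum_(1 <= l < k.+1)
    \sum_(q : l.-tuple V | simple_path e s q)
      (r \in s :: q)%:R * path_weight s q.

Definition path_prob (r s : V) (q : seq V) : R :=
  \prod_(1 <= i < (size q).+1) (#|nextD e r s q i|%:R)^-1.

End Centrality.

(* The transcript (s, l, [:: u_1; ..; u_j]) of one iteration: the chosen source
   and length, and the vertices drawn before the walk either reached length l
   (j = l) or had no admissible next vertex (j < l).                         *)
Definition transcript (V : finType) (k : nat) : finType :=
  (V * 'I_k.+1 * k.-bseq V)%type.

Section Algorithm.

Variables (R : realType) (V : finType) (e : rel V) (k : nat) (r : V).

(* The probability that the walk which has already drawn q after s, and still
   has n vertices to draw, draws exactly the vertices w from now on.          *)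
Fixpoint walk_prob (n : nat) (s : V) (q w : seq V) : R :=
  match n, w with
  | 0, [::] => 1
  | 0, _ :: _ => 0
  | n'.+1, [::] => (nextD e r s q (size q).+1 == finset.set0)%:R
  | n'.+1, v :: w' =>
      if v \in nextD e r s q (size q).+1
      then (#|nextD e r s q (size q).+1|%:R)^-1 *
           walk_prob n' s (rcons q v) w'
      else 0
  end.

Definition iteration_prob (o : transcript V k) : R :=
  let: (s, l, q) := o in
  if (s \in RF e r) && (0 < l)%N
  then (#|RF e r|%:R)^-1 * (k%:R)^-1 * walk_prob l s [::] q
  else 0.

Definition iteration_value (o : transcript V k) : R :=
  let: (s, l, q) := o in
  if (size q == l) && (r \in s :: q)
  then (#|RF e r|%:R * path_weight R e s q) /
       (#|V|%:R * path_prob R e r s q)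
  else 0.

End Algorithm.

Local Open Scope classical_set_scope.
Local Open Scope ereal_scope.

(* A finite type is regarded as a measurable space in which every set is
   measurable.                                                               *)

Definition random_element (d : measure_display) (Omega : measurableType d)
    (A : finType) (X : Omega -> A) : Prop :=
  forall B : set A, measurable (X @^-1` B).

Definition mutually_independent (R : realType) (d : measure_display)
    (Omega : measurableType d) (P : probability Omega R)
    (A I : finType) (X : I -> Omega -> A) : Prop :=
  forall B : I -> set A,
    P (\bigcap_i (X i @^-1` B i)) = \prod_(i : I) P (X i @^-1` B i).

Definition apad_iterations (R : realType) (V : finType) (e : rel V)
    (k : nat) (r : V) (tau : nat) (d : measure_display)
    (Omega : measurableType d) (P : probability Omega R)
    (X : 'I_tau -> Omega -> transcript V k) : Prop :=
  [/\ forall i, random_element (X i),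
      mutually_independent P X &
      forall i o, P (X i @^-1` [set o]) = (iteration_prob R e r o)%:E].

Definition apad_estimate (R : realType) (V : finType) (e : rel V)
    (k : nat) (r : V) (tau : nat) (Omega : Type)
    (X : 'I_tau -> Omega -> transcript V k) (w : Omega) : R :=
  ((tau%:R)^-1 * \sum_(i < tau) iteration_value R e r (X i w))%R.

(* Main.v *)
(** Every walk drawn by APAD is a simple path inside D(r).  Conversely, on a
    simple path through r starting at s <> r the vertices before r lie in RF(r)
    and those after it in RT(r), so such a path is drawn with the positive
    probability P[p], and the factor W(p)/P[p] makes one iteration an unbiased
    estimator of pc(r).  The iterations are independent, with the same law on a
    finite set, so the variance of their mean is Var/tau, and Chebyshev's
    inequality gives the bound as soon as tau >= Var / (delta * lambda^2). *)
Require Import Defs.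
From HB Require Import structures.
From mathcomp Require Import all_boot all_order all_algebra.
From mathcomp Require Import all_classical all_reals all_analysis.
From mathcomp Require Import ring.
Local Open Scope classical_set_scope.
Local Open Scope ring_scope.
Set Implicit Arguments.
Unset Strict Implicit.
Unset Printing Implicit Defensive.
Import Order.TTheory GRing.Theory Num.Theory.

Section SimplePaths.

Variables (V : finType) (e : rel V).

Lemma path_connect_last (s : V) (q : seq V) (x : V) :
  path e s q -> x \in s :: q -> connect e x (last s q).
Proof.
move=> + xq; case/splitPl: xq => q1 q2 <-.
rewrite cat_path last_cat => /andP[_ path_q2].
by apply/connectP; exists q2.
Qed.

Lemma path_connect_total (s : V) (q : seq V) (x y : V) :
  path e s q -> x \in s :: q -> y \in s :: q -> connect e x y || connect e y x.
Proof.
move=> path_q xq; case/splitPl: xq path_q => q1 q2 <-.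
rewrite cat_path -cat_cons mem_cat => /andP[path_q1 path_q2] /orP[yq1|yq2].
  by rewrite (path_connect_last path_q1 yq1) orbT.
by rewrite (path_connect path_q2) ?in_cons ?yq2 ?orbT.
Qed.

Lemma path_sub_DD (r s : V) (q : seq V) :
  path e s q -> r \in s :: q -> {subset s :: q <= DD e r}.
Proof.
move=> path_q rq x xq; rewrite !inE.
case: eqVneq => //= _; rewrite ?orbT ?orbF //.
exact: path_connect_total path_q xq rq.
Qed.

Lemma simple_path_rcons (s : V) (q : seq V) (v : V) :
  simple_path e s (rcons q v) =
  [&& simple_path e s q, v \notin s :: q & e (last s q) v].
Proof.
rewrite /simple_path rcons_path -rcons_cons rcons_uniq.
by rewrite (andbC (v \notin _)) andbACA (andbC (e _ _)).
Qed.

Lemma simple_path_catl (s : V) (q w : seq V) :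
  simple_path e s (q ++ w) -> simple_path e s q.
Proof.
rewrite /simple_path cat_path -cat_cons cat_uniq.
by move=> /andP[/andP[-> _] /andP[-> _]].
Qed.

End SimplePaths.

Section Walks.

Variables (R : realType) (V : finType) (e : rel V) (r : V).

Lemma nextD_rcons (s : V) (q : seq V) (v : V) (i : nat) :
  (i <= (size q).+1)%N -> nextD e r s (rcons q v) i = nextD e r s q i.
Proof.
move=> iq; rewrite /nextD /removed -rcons_cons nth_rcons /= ltnS.
have i1q : (i.-1 <= size q)%N by case: i iq.
by rewrite i1q -cats1 takel_cat // (leq_trans _ i1q) // -subn1 leq_sub2l.
Qed.

Lemma path_prob_rcons (s : V) (q : seq V) (v : V) :
  path_prob R e r s (rcons q v) =
  path_prob R e r s q * (#|nextD e r s q (size q).+1|%:R)^-1.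
Proof.
rewrite /path_prob size_rcons big_nat_recr //= nextD_rcons //; congr (_ * _).
by apply: eq_big_nat => i /andP[_ iq]; rewrite nextD_rcons // ltnW.
Qed.

Hypothesis e_irr : irreflexive e.

(* [removed] does not contain the current vertex [last s q]; the absence of
   loops excludes it. *)
Lemma mem_nextD_last (s : V) (q : seq V) (v : V) :
  (v \in nextD e r s q (size q).+1) =
  [&& v \notin s :: q, e (last s q) v & v \in DD e r].
Proof.
elim/last_ind: q => [|q u _]; first by rewrite !inE orbF.
rewrite /nextD /removed -last_nth size_rcons last_rcons !subSS subn0.
rewrite -cats1 take_size_cat // !inE mem_cat !inE.
case: (eqVneq v u) => [->|_]; first by rewrite e_irr !andbF.
by rewrite orbF.
Qed.

Lemma mem_nextD_simple_path (s : V) (q : seq V) (v : V) :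
  simple_path e s q ->
  (v \in nextD e r s q (size q).+1) =
  simple_path e s (rcons q v) && (v \in DD e r).
Proof. by move=> sq; rewrite mem_nextD_last simple_path_rcons sq andbA. Qed.

Lemma path_prob_gt0 (s : V) (q : seq V) :
  simple_path e s q -> {subset q <= DD e r} -> 0 < path_prob R e r s q.
Proof.
elim/last_ind: q => [|q v IH] sqv qD; first by rewrite /path_prob big_geq.
have sq : simple_path e s q by move: sqv; rewrite simple_path_rcons => /andP[].
rewrite path_prob_rcons mulr_gt0 ?IH //.
  by move=> x xq; rewrite qD // mem_rcons in_cons xq orbT.
rewrite invr_gt0 ltr0n; apply/card_gt0P; exists v.
by rewrite mem_nextD_simple_path // sqv qD // mem_rcons mem_head.
Qed.

(* Keeping the probability of the vertices already drawn as a factor turns each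
   step of the walk into [path_prob_rcons]. *)
Lemma walk_prob_cat (s : V) (q w : seq V) :
  simple_path e s q ->
  path_prob R e r s q * walk_prob R e r (size w) s q w =
  (simple_path e s (q ++ w) && all [in DD e r] w)%:R *
    path_prob R e r s (q ++ w).
Proof.
elim: w q => [|v w IH] q sq /=; first by rewrite cats0 sq mulr1 mul1r.
rewrite mem_nextD_simple_path // -cat_rcons.
case: (v \in DD e r); last by rewrite !andbF mulr0 mul0r.
have [sqv|nsqv] := boolP (simple_path e s (rcons q v)).
  by rewrite /= mulrA -(path_prob_rcons s q v) IH.
have /negbTE -> : ~~ simple_path e s (rcons q v ++ w).
  by apply: contra nsqv; exact: simple_path_catl.
by rewrite /= mulr0 mul0r.
Qed.

Lemma walk_probE (s : V) (q : seq V) :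
  walk_prob R e r (size q) s [::] q =
  (simple_path e s q && all [in DD e r] q)%:R * path_prob R e r s q.
Proof.
by rewrite -[RHS](@walk_prob_cat s [::]) // /path_prob big_geq // mul1r.
Qed.

End Walks.

Lemma sum_bseq_size (R : nmodType) (T : finType) (k l : nat) (F : seq T -> R) :
  (l <= k)%N ->
  \sum_(q : k.-bseq T | size q == l) F q = \sum_(q : l.-tuple T) F q.
Proof.
move=> lk.
have size_le (t : l.-tuple T) : (size t <= k)%N by rewrite size_tuple.
rewrite (reindex_omap (fun t => Bseq (size_le t))
  (fun q : k.-bseq T => insub (val q))) /=.
  by apply: eq_bigl => t; rewrite size_tuple eqxx valK /= eqxx.
by move=> q ql; rewrite insubT /=; congr Some; apply: val_inj.
Qed.

Section Unbiasedness.

Variables (R : realType) (V : finType) (e : rel V) (k : nat) (r : V).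

Definition path_contribution (s : V) (q : seq V) : R :=
  (k%:R * #|V|%:R)^-1 *
  ((simple_path e s q && (r \in s :: q))%:R * path_weight R e s q).

Lemma path_centralityE :
  path_centrality R e k r =
  \sum_(s | s != r) \sum_(l < k.+1 | (0 < l)%N) \sum_(q : l.-tuple V)
    path_contribution s q.
Proof.
rewrite /path_centrality big_distrr; apply: eq_bigr => s _.
rewrite big_geq_mkord big_distrr; apply: eq_bigr => l _.
rewrite big_mkcond big_distrr; apply: eq_bigr => q _ /=.
rewrite /path_contribution -mulnb natrM -mulrA.
by case: ifP; rewrite ?mul1r ?mul0r.
Qed.

Hypothesis e_irr : irreflexive e.

(* The factors |RF| and 1/P[p] of the value cancel the probabilities of the
   source and of the walk. *)
Lemma iteration_prob_mul_value (s : V) (l : 'I_k.+1) (q : k.-bseq V) :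
  iteration_prob R e r (s, l, q) * iteration_value R e r (s, l, q) =
  if [&& s != r, (0 < l)%N & size q == l] then path_contribution s q else 0.
Proof.
rewrite /iteration_prob /iteration_value /path_contribution.
have [ql|_] := eqVneq (size q) l; last by rewrite mulr0 !andbF.
have [rq|_] := boolP (r \in s :: q); last first.
  by rewrite !andbF mul0r !mulr0 if_same.
have [l_gt0|_] := boolP (0 < l)%N; last by rewrite !andbF mul0r.
rewrite !andbT -ql walk_probE //.
have [sq|_] := boolP (simple_path e s q); last first.
  by rewrite !(mul0r, mulr0) !if_same mul0r.
have path_q : path e s q by case/andP: sq.
have qD : {subset q <= DD e r}.
  by move=> x xq; apply: path_sub_DD path_q rq _ _; rewrite in_cons xq orbT.
have -> : (s \in RF e r) = (s != r).
  by rewrite inE (path_connect path_q rq) andbT.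
have [sr|_] := boolP (s != r); last by rewrite mul0r.
have RF_neq0 : #|RF e r|%:R != 0 :> R.
  rewrite pnatr_eq0 -lt0n; apply/card_gt0P; exists s.
  by rewrite inE sr (path_connect path_q rq).
have V_neq0 : #|V|%:R != 0 :> R.
  by rewrite pnatr_eq0 -lt0n; apply/card_gt0P; exists s.
have k_neq0 : k%:R != 0 :> R.
  by rewrite pnatr_eq0 -lt0n (leq_trans l_gt0) // -ltnS.
have pq_neq0 : path_prob R e r s q != 0 by rewrite gt_eqF // path_prob_gt0.
rewrite (introT allP qD) /=; field.
by rewrite pq_neq0 V_neq0 k_neq0 RF_neq0.
Qed.

Lemma iteration_unbiased :
  \sum_(o : transcript V k) iteration_prob R e r o * iteration_value R e r o =
  path_centrality R e k r.
Proof.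
transitivity (\sum_(s : V) \sum_(l < k.+1) \sum_(q : k.-bseq V)
   iteration_prob R e r (s, l, q) * iteration_value R e r (s, l, q)).
  by rewrite pair_bigA pair_bigA /=; apply: eq_bigr => -[[s l] q] _.
rewrite path_centralityE [RHS]big_mkcond; apply: eq_bigr => s _ /=.
under eq_bigr do under eq_bigr do rewrite iteration_prob_mul_value.
case: ifP => _ /=; last by rewrite big1 // => l _; rewrite big1.
rewrite [RHS]big_mkcond; apply: eq_bigr => l _ /=.
case: ifP => _ /=; last by rewrite big1.
have lk : (l <= k)%N by rewrite -ltnS.
by rewrite -big_mkcond -(sum_bseq_size (path_contribution s) lk).
Qed.

End Unbiasedness.

Section UncorrelatedSums.

Variables (R : realType) (d : measure_display) (T : measurableType d).
Variable P : probability T R.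

Lemma expectation_sum_seq (I : Type) (s : seq I) (X : I -> T -> R) :
  (forall i, X i \in Lfun P 1) ->
  ('E_P[(\sum_(i <- s) X i)%R] = \sum_(i <- s) 'E_P[X i])%E.
Proof.
move=> X1; elim: s => [|i s IH]; first by rewrite !big_nil expectation_cst.
by rewrite !big_cons expectationD ?IH ?rpred_sum.
Qed.

Lemma covariance_suml (I : Type) (s : seq I) (X : I -> T -> R) (Y : T -> R) :
  (forall i, X i \in Lfun P 2%:E) -> Y \in Lfun P 2%:E ->
  covariance P (\sum_(i <- s) X i) Y = (\sum_(i <- s) covariance P (X i) Y)%E.
Proof.
move=> X2 Y2; elim: s => [|i s IH]; first by rewrite !big_nil covariance_cst_l.
by rewrite !big_cons covarianceDl ?IH ?rpred_sum ?lee1n.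
Qed.

Lemma covariance_sumr (I : Type) (s : seq I) (X : I -> T -> R) (Y : T -> R) :
  (forall i, X i \in Lfun P 2%:E) -> Y \in Lfun P 2%:E ->
  covariance P Y (\sum_(i <- s) X i) = (\sum_(i <- s) covariance P Y (X i))%E.
Proof.
move=> X2 Y2; rewrite covarianceC covariance_suml //.
by apply: eq_bigr => i _; rewrite covarianceC.
Qed.

Lemma variance_sum_uncorrelated (I : finType) (X : I -> T -> R) :
  (forall i, X i \in Lfun P 2%:E) ->
  (forall i j, i != j -> covariance P (X i) (X j) = 0%E) ->
  ('V_P[(\sum_i X i)%R] = \sum_i 'V_P[X i])%E.
Proof.
move=> X2 X_uncorr; rewrite /variance covariance_suml ?rpred_sum ?lee1n //.
apply: eq_bigr => i _; rewrite covariance_sumr // (bigD1 i) //=.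
by rewrite big1 ?adde0 // => j ji; rewrite X_uncorr // eq_sym.
Qed.

Lemma chebyshev_sample_mean (n : nat) (X : 'I_n -> T -> R) (mu v eps : R) :
  (0 < n)%N -> 0 < eps ->
  (forall i, X i \in Lfun P 2%:E) ->
  (forall i j, i != j -> covariance P (X i) (X j) = 0%E) ->
  (forall i, 'E_P[X i] = mu%:E)%E -> (forall i, 'V_P[X i] = v%:E)%E ->
  (P [set w | (eps <= `|n%:R^-1 * (\sum_i X i w) - mu|)%R] <=
    (v / (n%:R * eps ^+ 2))%:E)%E.
Proof.
move=> n_gt0 eps_gt0 X2 X_uncorr EX VX.
have n_neq0 : n%:R != 0 :> R by rewrite pnatr_eq0 -lt0n.
have L1 Y : Y \in Lfun P 2%:E -> Y \in Lfun P 1.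
  by apply: Lfun_subset12; exact: fin_num_measure.
pose S : T -> R := \sum_i X i.
have S2 : S \in Lfun P 2%:E by rewrite rpred_sum ?lee1n.
pose M : T -> R := n%:R^-1 \o* S.
have M2 : M \in Lfun P 2%:E by rewrite Lfun_scale ?ler1n.
have EM : ('E_P[M] = mu%:E)%E.
  rewrite expectationZl ?L1 // expectation_sum_seq => [|i]; last exact: L1.
  under eq_bigr do rewrite EX.
  by rewrite sumEFin sumr_const card_ord -EFinM -[mu *+ n]mulr_natl mulKf.
have VM : ('V_P[M] = (v / n%:R)%:E)%E.
  rewrite varianceZ // variance_sum_uncorrelated //.
  under eq_bigr do rewrite VX.
  rewrite sumEFin sumr_const card_ord -EFinM -[v *+ n]mulr_natl; congr (_%:E).
  by rewrite expr2 -mulrA mulKf // mulrC.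
have ME w : n%:R^-1 * \sum_i X i w = M w by rewrite /M /S fct_sumE mulrC.
under eq_set do rewrite ME.
have := @chebyshev _ _ _ P (mfun_Sub (sub_Lfun_mfun M2)) _ eps_gt0.
rewrite [X in 'E_P[X]%E]/= [X in 'V_P[X]]/= EM VM -EFinM /=.
by rewrite mulrCA -invfM (mulrC (eps ^+ 2)).
Qed.

End UncorrelatedSums.

Section FiniteRange.

Variables (R : realType) (d : measure_display) (T : measurableType d).
Variables (P : probability T R) (A : finType).

Lemma random_element_preimage1 (Y : T -> A) :
  (forall a, measurable (Y @^-1` [set a])) -> random_element Y.
Proof.
move=> mY B.
have -> : Y @^-1` B = \bigcup_(a in B) (Y @^-1` [set a]).
  by apply/seteqP; split => [w Bw|w [a Ba /= ->]//]; exists (Y w).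
by apply: fin_bigcup_measurable => [|a _]; [exact: finite_finset | exact: mY].
Qed.

Definition finpmf (Y : T -> A) (a : A) : R := fine (P (Y @^-1` [set a])).

Variable Y : T -> A.
Hypothesis Y_random : random_element Y.

Lemma finpmfE (a : A) : P (Y @^-1` [set a]) = (finpmf Y a)%:E.
Proof. by rewrite fineK // fin_num_measure //; exact: Y_random. Qed.

Lemma Lfun_comp_random_element (F : A -> R) (p : R) : F \o Y \in Lfun P p%:E.
Proof.
have mcomp (G : A -> R) : measurable_fun [set: T] (G \o Y).
  by move=> _ B _; rewrite setTI comp_preimage; exact: Y_random.
rewrite inE; apply/andP; split; rewrite inE //=.
rewrite /finite_norm unlock poweR_lty //.
apply/integrable_lty => //.
apply: (measurable_bounded_integrable _ _ (mcomp (fun a => `|F a| `^ p))) => //.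
  by rewrite ltey_eq fin_num_measure.
exists (\sum_a `| (`|F a| `^ p) |); split; first exact: num_real.
move=> M FM w _ /=; apply: le_trans (ltW FM).
by rewrite (bigD1 (Y w)) //= lerDl sumr_ge0.
Qed.

Lemma expectation_comp_random_element (F : A -> R) :
  ('E_P[F \o Y] = (\sum_a finpmf Y a * F a)%:E)%E.
Proof.
have Lterm a : F a \o* \1_(Y @^-1` [set a]) \in Lfun P 1.
  by rewrite Lfun_scale //; apply/Lfun1_integrable/integrable_indic/Y_random.
have -> : F \o Y = \sum_a (F a \o* \1_(Y @^-1` [set a])).
  apply/funext => w; rewrite fct_sumE (bigD1 (Y w)) //= indicE mem_set // mul1r.
  rewrite big1 ?addr0 // => a aY; rewrite indicE memNset ?mul0r //=.
  exact/nesym/eqP.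
rewrite expectation_sum_seq // -sumEFin; apply: eq_bigr => a _.
rewrite expectationZl; last exact/Lfun1_integrable/integrable_indic/Y_random.
by rewrite expectation_indic ?finpmfE 1?mulrC //; exact: Y_random.
Qed.

Lemma variance_comp_random_element (F : A -> R) :
  ('V_P[F \o Y] =
    (\sum_a finpmf Y a * (F a - \sum_b finpmf Y b * F b) ^+ 2)%:E)%E.
Proof.
pose G a := (F a - \sum_b finpmf Y b * F b) ^+ 2.
rewrite /variance unlock expectation_comp_random_element.
exact: expectation_comp_random_element G.
Qed.

End FiniteRange.

Section Independence.

Variables (R : realType) (d : measure_display) (T : measurableType d).
Variables (P : probability T R) (A I : finType) (X : I -> T -> A).
Hypothesis X_random : forall i, random_element (X i).
Hypothesis X_indep : mutually_independent P X.

Lemma mutually_independent_setI (i j : I) (B C : set A) : i != j ->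
  P (X i @^-1` B `&` X j @^-1` C) = (P (X i @^-1` B) * P (X j @^-1` C))%E.
Proof.
move=> ij; pose D m := if m == i then B else if m == j then C else setT.
have Di : D i = B by rewrite /D eqxx.
have Dj : D j = C by rewrite /D eq_sym (negbTE ij) eqxx.
have DT m : m != i -> m != j -> D m = setT.
  by rewrite /D => /negbTE -> /negbTE ->.
have -> : X i @^-1` B `&` X j @^-1` C = \bigcap_m (X m @^-1` D m).
  apply/seteqP; split => [w [Bw Cw] m _|w XD].
    have [->|mi] := eqVneq m i; first by rewrite Di.
    by have [->|mj] := eqVneq m j; rewrite ?Dj // DT.
  by split; [rewrite -Di | rewrite -Dj]; exact: XD.
rewrite X_indep (bigD1 i) //= (bigD1 j) 1?eq_sym //= Di Dj.
rewrite big1 ?mule1 // => m /andP[mi mj].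
by rewrite DT // preimage_setT probability_setT.
Qed.

Lemma expectation_mul_independent (F G : A -> R) (i j : I) : i != j ->
  ('E_P[(F \o X i) * (G \o X j)] = 'E_P[F \o X i] * 'E_P[G \o X j])%E.
Proof.
move=> ij; pose XX w := (X i w, X j w).
have XX_setI a b :
    XX @^-1` [set (a, b)] = X i @^-1` [set a] `&` X j @^-1` [set b].
  by apply/seteqP; split => w [<- <-].
have XX_random : random_element XX.
  apply: random_element_preimage1 => -[a b]; rewrite XX_setI.
  by apply: measurableI; exact: X_random.
have -> : (F \o X i) * (G \o X j) = (fun ab => F ab.1 * G ab.2) \o XX by [].
rewrite !expectation_comp_random_element // -EFinM big_distrlr pair_bigA /=.
congr _%:E; apply: eq_bigr => -[a b] _ /=.
by rewrite {1}/finpmf XX_setI mutually_independent_setI // !finpmfE //= mulrACA.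
Qed.

Lemma covariance_independent (F G : A -> R) (i j : I) : i != j ->
  covariance P (F \o X i) (G \o X j) = 0%E.
Proof.
move=> ij; have L2 H m : H \o X m \in Lfun P 2%:E.
  exact: Lfun_comp_random_element.
have L1 H m : H \o X m \in Lfun P 1 by exact: Lfun_comp_random_element.
rewrite covarianceE ?Lfun2_mul_Lfun1 // expectation_mul_independent //.
by rewrite !expectation_comp_random_element // -EFinM subee.
Qed.

End Independence.

Lemma chebyshev_iid_finite (R : realType) (d : measure_display)
    (T : measurableType d) (P : probability T R) (A : finType) (n : nat)
    (X : 'I_n -> T -> A) (p F : A -> R) (mu eps : R) :
  (0 < n)%N -> 0 < eps ->
  (forall i, random_element (X i)) -> mutually_independent P X ->
  (forall i a, P (X i @^-1` [set a]) = (p a)%:E) -> \sum_a p a * F a = mu ->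
  (P [set w | (eps <= `|n%:R^-1 * (\sum_i F (X i w)) - mu|)%R] <=
    ((\sum_a p a * (F a - mu) ^+ 2) / (n%:R * eps ^+ 2))%:E)%E.
Proof.
move=> n_gt0 eps_gt0 X_random X_indep X_law mean.
have pmf i : finpmf P (X i) = p by apply/funext => a; rewrite /finpmf X_law.
apply: (chebyshev_sample_mean (X := fun i => F \o X i)) => // [i|i j ij|i|i].
- exact: Lfun_comp_random_element.
- exact: covariance_independent.
- by rewrite expectation_comp_random_element // pmf mean.
- by rewrite variance_comp_random_element // pmf mean.
Qed.

Theorem theorem5p2 (R : realType) (V : finType) (e : rel V)
    (e_irr : irreflexive e) (e_conn : weakly_connected e)
    (k : nat) (k_ge1 : (1 <= k)%N)
    (r : V) (r_in : (0 < #|inN e r|)%N) (r_out : (0 < #|outN e r|)%N)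
    (lambda delta : R)
    (lambda01 : 0 < lambda < 1) (delta01 : 0 < delta < 1) :
  exists T0 : nat, forall tau : nat, (T0 <= tau)%N ->
    forall (d : measure_display) (Omega : measurableType d)
           (P : probability Omega R)
           (X : 'I_tau -> Omega -> transcript V k),
    apad_iterations e r P X ->
    (P [set w | (lambda <=
         `|apad_estimate R e r X w - path_centrality R e k r|)%R]
       <= delta%:E)%E.
Proof.
have /andP[lambda_gt0 _] := lambda01; have /andP[delta_gt0 _] := delta01.
pose v := \sum_(o : transcript V k) iteration_prob R e r o *
  (iteration_value R e r o - path_centrality R e k r) ^+ 2.
exists (Num.truncn (v / (delta * lambda ^+ 2))).+1 => tau tau_large d Omega P X.
move=> [X_random X_indep X_law].
have tau_gt0 : (0 < tau)%N by apply: leq_trans tau_large.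
have tau_ge : v / (delta * lambda ^+ 2) <= tau%:R.
  by apply: ltW; apply: lt_le_trans (truncnS_gt _) _; rewrite ler_nat.
have := chebyshev_iid_finite tau_gt0 lambda_gt0 X_random X_indep X_law
  (iteration_unbiased R k r e_irr).
move=> /le_trans; apply; rewrite lee_fin -/v.
rewrite ler_pdivrMr ?mulr_gt0 ?exprn_gt0 ?ltr0n //.
by rewrite mulrCA -ler_pdivrMr ?mulr_gt0 ?exprn_gt0.
Qed.
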